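(* Let $S$ and $T$ be reflections on a complex Hilbert space, and let $|\psi\rangle$ be a state in that space. Consider the following protocol, starting from the state $|\psi\rangle$: (1) measure $S$; (2) measure $T$, but ignore the result; (3) measure $S$ again, and accept if the result is the same as the result of step (1). Then the probability of accepting is $$\Pr[\mathrm{accept}] = 1 - \tfrac18 \big\| [S, T] |\psi\rangle \big\|^2 .$$
   Context: A reflection is a Hermitian operator that squares to the identity. A state is a unit vector. Measuring a reflection $R$ on a state $|\phi\rangle$ gives outcome $(-1)^a$, $a \in \{0,1\}$, with probability $\|R_a |\phi\rangle\|^2$ where $R_a = \frac12(\mathbf 1 + (-1)^a R)$, and the post-measurement state is $R_a|\phi\rangle / \|R_a|\phi\rangle\|$. Thus the probability that successive measurements of reflections $R^{(1)}, R^{(2)}, R^{(3)}$ yield outcomes $(-1)^{a_1}, (-1)^{a_2}, (-1)^{a_3}$ is $\|R^{(3)}_{a_3} R^{(2)}_{a_2} R^{(1)}_{a_1} |\psi\rangle\|^2$. $[S,T] = ST - TS$. *)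

(* Defs.v *)
From HB Require Import structures.
From mathcomp Require Import all_boot all_order all_algebra.
From mathcomp Require Import sesquilinear.
From mathcomp Require Import all_classical all_reals all_analysis.
From mathcomp Require Import complex.

Set Implicit Arguments.
Unset Strict Implicit.
Unset Printing Implicit Defensive.

Import Order.TTheory GRing.Theory Num.Theory.
Import numFieldNormedType.Exports.

Local Open Scope ring_scope.
Local Open Scope complex_scope.

(* A complex Hilbert space is a Banach space over R[i] whose norm is induced
   by an inner product. As in sesquilinear.v, the inner product is linear on
   the left and conjugate-linear on the right; the physicists' convention is
   the same form with its arguments exchanged. *)
HB.mixin Record isHilbert (R : realType) H & CompleteNormedModule R[i] H := {
  inner : {dot H for (@Num.conj R[i])};
  inner_norm : forall x : H, inner x x = `|x| ^+ 2
}.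

#[short(type="hilbertType")]
HB.structure Definition Hilbert (R : realType) :=
  {H of CompleteNormedModule R[i] H & isHilbert R H}.

Section Reflections.
Context {R : realType} {H : hilbertType R}.
Implicit Types (A S T : {linear H -> H}) (x phi : H) (a b : bool).

(* The norm of a normedModType over R[i] takes its values in R[i], on
   nonnegative reals; hnorm is the same norm with values in R. *)
Definition hnorm x : R := complex.Re `|x|.

Definition is_state phi := hnorm phi = 1.

(* Operators are defined on all of H, so symmetry is self-adjointness and
   boundedness is automatic (Hellinger-Toeplitz). *)
Definition hermitian_op A := forall x y : H, inner (A x) y = inner x (A y).

Definition is_reflection A := hermitian_op A /\ involutive A.

(* The boolean a stands for the outcome (-1)^a. *)
Definition outcome_op A a : H -> H :=
  fun x => 2%:R^-1 *: (x + (-1) ^+ a *: A x).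

Definition outcome_prob A a phi : R := hnorm (outcome_op A a phi) ^+ 2.

(* This is 0, rather than a state, when the outcome has probability 0. *)
Definition post_state A a phi : H :=
  ((hnorm (outcome_op A a phi))^-1)%:C *: outcome_op A a phi.

(* The probability that measuring the first components in order, starting
   from phi, yields the second components as outcomes. After an outcome of
   probability 0 the value of the remaining factors is irrelevant. *)
Fixpoint outcomes_prob (ms : seq ({linear H -> H} * bool)) phi : R :=
  if ms is (A, a) :: ms' then
    outcome_prob A a phi * outcomes_prob ms' (post_state A a phi)
  else 1.

Definition accept_prob S T phi : R :=
  \sum_(a1 : bool) \sum_(a2 : bool) \sum_(a3 : bool | a3 == a1)
    outcomes_prob [:: (S, a1); (T, a2); (S, a3)] phi.

Definition commutator S T : H -> H := fun x => S (T x) - T (S x).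

End Reflections.

(* Main.v *)
(* Write S_a = (1 + s S)/2 and T_b = (1 + t T)/2 with signs s and t. The
   unnormalised final vector S_a T_b S_a psi is half of u + t S_a T u, where
   u = S_a psi, and S_a T S_a psi is a quarter of S K psi + s K psi, where
   K = S T + T S. The parallelogram law, summing over t and then over s, gives
   acceptance probability 1/2 + |K psi|^2 / 8, because S is an isometry, and
   applied to ST psi and TS psi it gives |K psi|^2 + |[S, T] psi|^2 = 4. *)
Require Import Defs.
From HB Require Import structures.
From mathcomp Require Import all_boot all_order all_algebra.
From mathcomp Require Import sesquilinear.
From mathcomp Require Import all_classical all_reals all_analysis.
From mathcomp Require Import complex.
From mathcomp Require Import ring lra.

Import Order.TTheory GRing.Theory Num.Theory.
Import numFieldNormedType.Exports.

Local Open Scope ring_scope.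
Local Open Scope complex_scope.

Section Measurement.
Context {R : realType} {H : hilbertType R}.
Implicit Types (A S T : {linear H -> H}) (x y v : H) (a b : bool).
Implicit Types (ms : seq ({linear H -> H} * bool)).

Lemma hnormE x : (hnorm x)%:C = `|x|.
Proof. by rewrite /hnorm; apply/RRe_real/ger0_real/normr_ge0. Qed.

Lemma hnorm_sqr x : (hnorm x ^+ 2)%:C = inner x x.
Proof. by rewrite inner_norm rmorphXn /= hnormE. Qed.

Lemma hnorm_ge0 x : 0 <= hnorm x.
Proof. by rewrite -(@lecR R) hnormE; exact: normr_ge0. Qed.

Lemma hnorm0_eq0 x : (hnorm x == 0) = (x == 0).
Proof. by rewrite -(inj_eq (@complexI R)) hnormE normr_eq0. Qed.

Lemma hnormZ (c : R) x : hnorm (c%:C *: x) = `|c| * hnorm x.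
Proof.
apply: (@complexI R); rewrite hnormE normrZ rmorphM /= hnormE.
by rewrite normc_def /= expr0n addr0 sqrtr_sqr.
Qed.

Lemma hnorm_parallelogram x y :
  hnorm (x + y) ^+ 2 + hnorm (x - y) ^+ 2 = 2 * (hnorm x ^+ 2 + hnorm y ^+ 2).
Proof.
(* The embedding of [R] into [R[i]] is injective, so the identity may be checked there, where inner
   products expand and the cross terms cancel. *)
apply: (@complexI R); rewrite rmorphM !rmorphD /= !hnorm_sqr.
rewrite !linearDl !linearDr !linearNl !linearNr /= rmorph1.
ring.
Qed.

Lemma hnorm_half x : hnorm (2%:R^-1 *: x) ^+ 2 = hnorm x ^+ 2 / 4.
Proof.
have -> : 2%:R^-1 = (2^-1 : R)%:C by rewrite fmorphV /= rmorph_nat.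
by rewrite hnormZ exprMn real_normK ?num_real//; field.
Qed.

(** Here [y] is arbitrary, not just [A x], so that this covers the sum over the outcomes of [T] as
    well as the sums over those of [S]. *)
Lemma sum_hnorm_half x y :
  \sum_(a : bool) hnorm (2%:R^-1 *: (x + (-1) ^+ a *: y)) ^+ 2 =
  (hnorm x ^+ 2 + hnorm y ^+ 2) / 2.
Proof.
rewrite big_bool /= !hnorm_half expr0 expr1 scale1r scaleN1r -mulrDl addrC.
by rewrite hnorm_parallelogram; field.
Qed.

Lemma reflection_hnorm A x : is_reflection A -> hnorm (A x) = hnorm x.
Proof.
move=> [hA iA]; apply/eqP; rewrite -(@eqrXn2 _ 2) ?hnorm_ge0//.
by apply/eqP/(@complexI R); rewrite !hnorm_sqr hA iA.
Qed.

Lemma outcome_opZ A a (c : R[i]) x :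
  outcome_op A a (c *: x) = c *: outcome_op A a x.
Proof.
rewrite /outcome_op linearZ /= !scalerDr !scalerA.
by congr (_ *: _ + _ *: _); ring.
Qed.

Lemma outcome_opD A a x y :
  outcome_op A a (x + y) = outcome_op A a x + outcome_op A a y.
Proof.
rewrite /outcome_op [A _]linearD [_ *: (A x + _)]scalerDr.
by rewrite addrACA scalerDr.
Qed.

(** Up to the sign, [A] exchanges the two summands [x] and [(-1) ^+ a *: A x]. *)
Lemma outcome_op_eigen A a x : involutive A ->
  A (outcome_op A a x) = (-1) ^+ a *: outcome_op A a x.
Proof.
move=> iA; rewrite /outcome_op [A (_ *: _)]linearZ [A (_ + _)]linearD.
rewrite [A (_ *: A x)]linearZ /= iA [RHS]scalerA [_ * 2^-1]mulrC -scalerA.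
by rewrite [(-1) ^+ a *: (x + _)]scalerDr signrZK addrC.
Qed.

Lemma outcome_op_idem A a x : involutive A ->
  outcome_op A a (outcome_op A a x) = outcome_op A a x.
Proof.
move=> iA; rewrite {1}/outcome_op outcome_op_eigen// signrZK.
by rewrite -mulr2n -scalerMnr scalerMnl -mulr_natr mulVf ?scale1r// pnatr_eq0.
Qed.

(** With s the sign, (1 + s S) T (1 + s S) = T + S T S + s K, and T + S T S = S K since S squares to
    1. *)
Lemma outcome_op_sandwich S T a x : involutive S ->
  outcome_op S a (T (outcome_op S a x)) =
  2%:R^-1 *: (2%:R^-1 *: (S (S (T x) + T (S x)) +
                          (-1) ^+ a *: (S (T x) + T (S x)))).
Proof.
move=> iS; rewrite {2}/outcome_op [T _]linearZ outcome_opZ /outcome_op.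
rewrite [T (_ + _)]linearD [T (_ *: _)]linearZ /=.
rewrite [S (_ + _ *: _)]linearD [S (_ *: _)]linearZ [S (S _ + _)]linearD /= iS.
congr (_ *: (_ *: _)); rewrite !scalerDr signrZK.
by rewrite addrACA [RHS]addrACA [X in _ + X = _]addrC.
Qed.

Definition outcomes_op ms x : H :=
  foldl (fun v m => outcome_op m.1 m.2 v) x ms.

Lemma outcomes_op0 ms : outcomes_op ms 0 = 0.
Proof.
elim: ms => //= -[A a] ms IH; rewrite /outcomes_op /=.
by rewrite /outcome_op linear0 scaler0 addr0 scaler0.
Qed.

(** The weight [hnorm v ^+ 2] makes the induction go through: each normalisation in [post_state] is
    paid for by the probability of the previous outcome. If an outcome has probability 0, both sides
    vanish. *)
Lemma outcomes_prob_normalized ms v :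
  hnorm v ^+ 2 * outcomes_prob ms ((hnorm v)^-1%:C *: v) =
  hnorm (outcomes_op ms v) ^+ 2.
Proof.
elim: ms v => [|[A a] ms IH] v; first by rewrite mulr1.
have [->|v0] := eqVneq v 0.
  rewrite outcomes_op0 (_ : hnorm 0 = 0) ?expr0n ?mul0r//.
  by apply/eqP; rewrite hnorm0_eq0.
have n0 : hnorm v != 0 by rewrite hnorm0_eq0.
rewrite /= -IH /outcome_prob /post_state outcome_opZ hnormZ.
rewrite ger0_norm ?invr_ge0 ?hnorm_ge0// scalerA -rmorphM /= mulrA.
by rewrite invfM invrK [_ / hnorm v]mulrAC -exprMn mulrA divff// !mul1r.
Qed.

Lemma outcomes_probE ms psi : is_state psi ->
  outcomes_prob ms psi = hnorm (outcomes_op ms psi) ^+ 2.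
Proof.
move=> n1; rewrite -outcomes_prob_normalized n1 expr1n mul1r invr1.
by rewrite scale1r.
Qed.

Lemma sum_outcome_op A x : is_reflection A ->
  \sum_(a : bool) hnorm (outcome_op A a x) ^+ 2 = hnorm x ^+ 2.
Proof. by move=> rA; rewrite sum_hnorm_half reflection_hnorm//; field. Qed.

Lemma accept_probE S T psi : is_reflection S -> is_state psi ->
  accept_prob S T psi = 2^-1 +
    2^-1 * \sum_(a : bool) hnorm (outcome_op S a (T (outcome_op S a psi))) ^+ 2.
Proof.
move=> rS n1; have [_ iS] := rS.
have -> : accept_prob S T psi = \sum_(a : bool)
    (hnorm (outcome_op S a psi) ^+ 2 +
     hnorm (outcome_op S a (T (outcome_op S a psi))) ^+ 2) / 2.
  apply: eq_bigr => a _; rewrite -sum_hnorm_half; apply: eq_bigr => b _.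
  rewrite big_pred1_eq outcomes_probE// /outcomes_op /=.
  (* Only T_b is unfolded: for u = S_a psi, linearity and S_a u = u turn S_a T_b u into half of u +
     t S_a T u. *)
  rewrite -[outcome_op T b _]/(2%:R^-1 *: (_ + _ *: T _)) outcome_opZ.
  rewrite outcome_opD outcome_op_idem//.
  by rewrite [outcome_op S a (_ ^+ b *: _)]outcome_opZ.
by rewrite -mulr_suml big_split /= sum_outcome_op// n1; field.
Qed.

Lemma hnorm_commutator S T psi :
  is_reflection S -> is_reflection T -> is_state psi ->
  hnorm (S (T psi) + T (S psi)) ^+ 2 + hnorm (commutator S T psi) ^+ 2 = 4.
Proof.
move=> rS rT n1; rewrite hnorm_parallelogram !reflection_hnorm// n1.
by ring.
Qed.

End Measurement.

Theorem theorem4p1 (R : realType) (H : hilbertType R) (S T : {linear H -> H})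
    (S_refl : is_reflection S) (T_refl : is_reflection T)
    (psi : H) (psi_state : is_state psi) :
  accept_prob S T psi = 1 - 8%:R^-1 * hnorm (commutator S T psi) ^+ 2.
Proof.
have [_ iS] := S_refl.
rewrite accept_probE//.
(* Only the outer half is extracted, as a factor 1/4; the inner one is consumed by
   [sum_hnorm_half]. *)
under eq_bigr do rewrite outcome_op_sandwich// hnorm_half.
rewrite -mulr_suml sum_hnorm_half reflection_hnorm//.
have := hnorm_commutator _ _ _ S_refl T_refl psi_state.
by lra.
Qed.
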